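(* Let $W=\mathop{\wr}\limits_{i=1}^{\infty}S_{n_i}$ with all $n_i\ge 3$. The topological group $W$ is homeomorphic to the Cantor set $\mathbb{C}_{1/3}$.
   Context: $W$ is the infinite iterated permutational wreath product of finite symmetric groups with natural actions, i.e. the inverse limit $\varprojlim W_k$ of the finite iterated wreath products $W_k=\wr_{i=1}^{k}S_{n_i}$ under the natural projections $W_{k+1}\to W_k$, equipped with the profinite topology (the subspace topology from the product of the finite discrete groups $W_k$; a base of neighbourhoods of the identity is given by the subgroups $W^{(k)}$ of elements acting trivially on the first levels up to the $k$-th). Equivalently, $W$ is topologized as the countable product over all levels of the finite discrete sets of permutation tuples at that level. $\mathbb{C}_{1/3}$ is the standard Cantor middle-thirds set. *)

(* Defs.v *)
From HB Require Import structures.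
From mathcomp Require Import all_boot all_order all_algebra all_fingroup.
From mathcomp Require Import all_classical all_reals all_analysis.
Set Implicit Arguments.
Unset Strict Implicit.
Unset Printing Implicit Defensive.
Import Order.TTheory GRing.Theory Num.Theory.
Import numFieldNormedType.Exports.
Local Open Scope classical_set_scope.

(* A finite group together with a (right) action on a finite set. *)
Record actingGroup := ActingGroup {
  ag_group : finGroupType;
  ag_set : finType;
  ag_act : {action ag_group &-> ag_set}
}.

Definition sym_acting (n : nat) : actingGroup :=
  ActingGroup (perm_action 'I_n).

(* The permutational wreath product of A, acting on X, and B, acting on Y, is
   the semidirect product of the base group B^X and A, which permutes the
   factors. It acts on X * Y; since (a, f) : sdprod_by _ stands for the product
   a f, it sends (x, y) to (x a, y (f (x a))). *)
Section Wreath.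
Variables A B : actingGroup.
Local Open Scope group_scope.

Local Notation base := {dffun forall _ : ag_set A, ag_group B}.

Definition base_act (f : base) (a : ag_group A) : base :=
  [ffun x => f (ag_act A x a^-1)].

Lemma base_act1 : base_act^~ 1 =1 id.
Proof. by move=> f; apply/ffunP => x; rewrite ffunE invg1 act1. Qed.

Lemma base_actM f : act_morph base_act f.
Proof. by move=> a b; apply/ffunP => x; rewrite !ffunE invMg actM. Qed.

Definition base_action : {action ag_group A &-> base} :=
  TotalAction base_act1 base_actM.

Lemma base_is_groupAction :
  is_groupAction [set: base]%SET base_action.
Proof.
move=> a _; rewrite inE; apply/andP; split.
  by apply/fintype.subsetP => f _; rewrite inE.
apply/morphicP => f g _ _; rewrite !actpermE.
by apply/ffunP => x; rewrite !ffunE.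
Qed.

Definition base_groupAction : groupAction [set: ag_group A]%SET [set: base]%SET :=
  GroupAction base_is_groupAction.

Definition wreath_group : finGroupType := sdprod_by base_groupAction.

Definition wreath_act (xy : ag_set A * ag_set B) (u : wreath_group) :
    ag_set A * ag_set B :=
  let: (a, f) := pair_of_sd u in
  let x' := ag_act A xy.1 a in (x', ag_act B xy.2 (f x')).

Lemma wreath_act1 : wreath_act^~ 1 =1 id.
Proof. by case=> x y; rewrite /wreath_act /= !ffunE !act1. Qed.

Lemma wreath_actM xy : act_morph wreath_act xy.
Proof.
case: xy => x y [[a f] Pa] [[b g] Pb]; rewrite /wreath_act /= !actM !ffunE.
by rewrite -[in f _]actM mulgV act1 actM.
Qed.

Definition wreath : actingGroup :=
  @ActingGroup wreath_group (ag_set A * ag_set B)%type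
    (TotalAction wreath_act1 wreath_actM).

Definition wreath_proj (u : ag_group wreath) : ag_group A := (pair_of_sd u).1.

Lemma wreath_projM : {morph wreath_proj : u v / u * v}.
Proof. by []. Qed.

End Wreath.

(* The inverse limit of a sequence of finite groups, as a subspace of the
   product of the discrete groups. *)
Section InverseLimit.
Variables (G : nat -> finGroupType) (pr : forall k, G k.+1 -> G k).
Arguments pr k _ : clear implicits.
Hypothesis prM : forall k, {morph pr k : x y / (x * y)%g}.

Definition coherent : set (prod_topology (fun k => discrete_topology (G k))) :=
  [set g | forall k, pr k (g k.+1) = g k].

Definition invlim (_ : forall k, {morph pr k : x y / (x * y)%g}) : Type :=
  set_type coherent.

Local Notation L := (invlim prM).
HB.instance Definition _ := Topological.copy L (set_type coherent).

Definition coord (g : L) (k : nat) : G k := \val g k.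

Lemma coordP (g : L) k : pr k (coord g k.+1) = coord g k.
Proof. by case: g => g gP; exact: (set_mem gP). Qed.

Definition of_coords (g : forall k, G k) (gP : forall k, pr k (g k.+1) = g k) : L :=
  exist _ (g : prod_topology (fun k => discrete_topology (G k)))
    (@mem_set _ coherent g gP).

Lemma coord_inj (g h : L) : (forall k, coord g k = coord h k) -> g = h.
Proof. by move=> gh; apply: val_inj; apply: functional_extensionality_dep. Qed.

Lemma pr1 k : pr k (1 : G k.+1)%g = 1%g.
Proof. by apply: (mulgI (pr k 1)); rewrite -prM !mulg1. Qed.

Lemma prV k (x : G k.+1) : pr k x^-1%g = (pr k x)^-1%g.
Proof. by apply: (mulgI (pr k x)); rewrite -prM !mulgV pr1. Qed.

Lemma coherentM (g h : L) k :
  pr k (coord g k.+1 * coord h k.+1)%g = (coord g k * coord h k)%g.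
Proof. by rewrite prM !coordP. Qed.

Lemma coherentV (g : L) k : pr k (coord g k.+1)^-1%g = (coord g k)^-1%g.
Proof. by rewrite prV coordP. Qed.

Definition invlim_one : L := of_coords pr1.
Definition invlim_inv (g : L) : L := of_coords (coherentV g).
Definition invlim_mul (g h : L) : L := of_coords (coherentM g h).

Lemma invlim_mulA : associative invlim_mul.
Proof. by move=> f g h; apply: coord_inj => k; exact: mulgA. Qed.
Lemma invlim_mul1 : left_id invlim_one invlim_mul.
Proof. by move=> g; apply: coord_inj => k; exact: mul1g. Qed.
Lemma invlim_mulr1 : right_id invlim_one invlim_mul.
Proof. by move=> g; apply: coord_inj => k; exact: mulg1. Qed.
Lemma invlim_mulV : left_inverse invlim_one invlim_inv invlim_mul.
Proof. by move=> g; apply: coord_inj => k; exact: mulVg. Qed.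
Lemma invlim_mulrV : right_inverse invlim_one invlim_inv invlim_mul.
Proof. by move=> g; apply: coord_inj => k; exact: mulgV. Qed.

HB.instance Definition _ := isGroup.Build L
  invlim_mulA invlim_mul1 invlim_mulr1 invlim_mulV invlim_mulrV.

Lemma coord_continuous k :
  continuous (fun g : L => coord g k : discrete_topology (G k)).
Proof.
move=> g; apply: (@continuous_comp L
  (prod_topology (fun k => discrete_topology (G k))) _ \val (proj k)).
  exact: initial_continuous.
exact: proj_continuous.
Qed.

Lemma continuous_to_invlim (T : topologicalType) (f : T -> L) :
  (forall k, continuous (fun t => coord (f t) k : discrete_topology (G k))) ->
  continuous f.
Proof.
move=> cf; apply: (@continuous_comp_initial _ _ _ \val) => t.
apply/cvg_sup => k U [_ [[V oV <-] /= Vft] sVU].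
by apply: filterS sVU _; apply: (cf k t); exact: open_nbhs_nbhs.
Qed.

Lemma invlim_inv_continuous : continuous (fun g : L => g^-1%g).
Proof.
apply: continuous_to_invlim => k g.
apply: (@continuous_comp _ (discrete_topology (G k)) _ (coord^~ k)
  (fun x => (x : G k)^-1%g : discrete_topology (G k))).
  exact: coord_continuous.
by move=> U; rewrite !nbhs_principalE => /principal_filterP ?;
  apply/principal_filterP.
Qed.

Lemma invlim_mul_continuous :
  continuous (fun gh : L * L => (gh.1 * gh.2)%g : L).
Proof.
apply: continuous_to_invlim => k -[g h] U.
rewrite nbhs_principalE => /principal_filterP /= Ugh.
exists ([set g' | coord g' k = coord g k], [set h' | coord h' k = coord h k]).
  by split; apply: (@coord_continuous k _ [set _]); rewrite nbhs_principalE;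
    exact/principal_filterP.
by move=> [g' h'] /= [g'g h'h]; rewrite /coord /= -/(coord g' k) -/(coord h' k)
  g'g h'h.
Qed.

End InverseLimit.

(* With n i standing for n_{i+1}, iter_wreath n k is W_{k+1}, the iterated
   wreath product of S_{n_1}, ..., S_{n_{k+1}}. *)
Fixpoint iter_wreath (n : nat -> nat) (k : nat) : actingGroup :=
  if k is k'.+1 then wreath (iter_wreath n k') (sym_acting (n k))
  else sym_acting (n 0).

Definition iter_wreath_proj (n : nat -> nat) (k : nat) :
    ag_group (iter_wreath n k.+1) -> ag_group (iter_wreath n k) :=
  @wreath_proj (iter_wreath n k) (sym_acting (n k.+1)).

Lemma iter_wreath_projM (n : nat -> nat) (k : nat) :
  {morph @iter_wreath_proj n k : x y / (x * y)%g}.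
Proof. exact: wreath_projM. Qed.

Definition inf_wreath (n : nat -> nat) : Type :=
  @invlim (fun k => ag_group (iter_wreath n k)) (@iter_wreath_proj n)
    (@iter_wreath_projM n).

HB.instance Definition _ (n : nat -> nat) := Topological.on (inf_wreath n).
HB.instance Definition _ (n : nat -> nat) := Group.on (inf_wreath n).

Section CantorSet.
Variable R : realType.
Local Open Scope ring_scope.

(* When A is obtained from [0, 1] by k rounds of deleting open middle thirds,
   cantor_step A is the result of k.+1 rounds. *)
Definition cantor_step (A : set R) : set R :=
  [set x / 3 | x in A] `|` [set 2 / 3 + x / 3 | x in A].

Definition cantor_set : set R :=
  \bigcap_k iter k cantor_step `[0, 1]%classic.

End CantorSet.

Arguments cantor_set : clear implicits.

Definition homeomorphic (X Y : topologicalType) : Prop :=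
  exists (f : X -> Y) (g : Y -> X),
    [/\ cancel f g, cancel g f, continuous f & continuous g].

(* Main.v *)
From HB Require Import structures.
From mathcomp Require Import all_boot all_order all_algebra all_fingroup lra.
From mathcomp Require Import all_classical all_reals all_analysis.
Require Import Defs.
Set Implicit Arguments.
Unset Strict Implicit.
Unset Printing Implicit Defensive.
Import Order.TTheory GRing.Theory Num.Theory.
Import numFieldNormedType.Exports.
Local Open Scope classical_set_scope.

(** By Brouwer's characterization, a nonempty metrizable space that is compact,
zero-dimensional, Hausdorff and without isolated points is homeomorphic to the
Cantor space of binary sequences. Both sides of the theorem are such spaces, so
each is homeomorphic to binary sequences, and the two homeomorphisms compose.

The group is an inverse limit of finite discrete groups. The coherence
equations cut out a closed subset of a product of finite spaces, which makes
the limit compact by Tychonoff ([invlim_compact]); fixing one coordinate is a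
clopen condition, and distinct points differ in some coordinate
([invlim_zero_dimensional]). There are no isolated points as soon as every
fibre of every projection has at least two elements: follow a point up to level
n, leave it at the next level, and continue arbitrarily; these points tend to
the given one ([invlim_perfect]). In the wreath product, the fibre over an
element of the acting group is a copy of the base group, which is nontrivial
since a symmetric group on at least two letters is ([wreath_proj_fiber]).

For the middle-thirds set everything comes from the decomposition into two
copies of itself scaled by 1/3, through the maps sending x to x / 3 and to
2 / 3 + x / 3. By induction on k it gives, between two points at distance more
than 3^-k, a point removed by the k-th stage ([cantor_iter_gap]), hence a clopen
set separating them; and it gives, within 3^-k of any point, another point of
the set ([cantor_set_near]). *)

(** * Brouwer's characterization of the Cantor space *)

Lemma homeomorphic_sym (X Y : topologicalType) :
  homeomorphic X Y -> homeomorphic Y X.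
Proof. by move=> [f [g [fK gK cf cg]]]; exists g, f; split. Qed.

Lemma homeomorphic_trans (X Y Z : topologicalType) :
  homeomorphic X Y -> homeomorphic Y Z -> homeomorphic X Z.
Proof.
move=> [f [f' [fK f'K cf cf']]] [g [g' [gK g'K cg cg']]].
exists (g \o f), (f' \o g'); split; try exact: can_comp.
- by move=> x; apply: continuous_comp; [exact: cf|exact: cg].
- by move=> z; apply: continuous_comp; [exact: cg'|exact: cf'].
Qed.

(** The characterization [homeomorphism_cantor_like] is about pointed spaces and
produces a continuous closed bijection; a base point is supplied here, and a
closed bijection has a continuous inverse. *)
Lemma cantor_like_homeomorphic (R : realType) (T : pseudoMetricType R) :
  inhabited T -> cantor_like T -> homeomorphic cantor_space T.
Proof.
move=> [x0] clT.
pose P : pseudoPMetricType R := HB.pack (T : Type) (isPointed.Build T x0)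
  (PseudoMetric.on T).
have [f [cf clf]] := @homeomorphism_cantor_like R P clT.
pose g (y : T) : cantor_space := (f^-1)%FUN (y : P).
have fK : cancel f g by move=> x; apply: funK; rewrite inE.
have gK : cancel g f by move=> y; apply: invK; rewrite inE.
exists (f : cantor_space -> T), g; split=> //.
apply/continuous_closedP => A clA.
suff <- : f @` A = g @^-1` A by exact: clf.
rewrite eqEsubset; split => [_ [x Ax <-]|y Agy]; first by rewrite /preimage/= fK.
by exists (g y).
Qed.

Lemma zero_dimensional_hausdorff (T : topologicalType) :
  zero_dimensional T -> hausdorff_space T.
Proof.
move=> zdT; rewrite open_hausdorff => x y /zdT[U [[oU cU] Ux Uy]].
exists (U, ~` U); first by rewrite !inE.
by split=> //=; [exact: closed_openC|rewrite setICr].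
Qed.

(** A filter on the subspace pushes forward to a filter on the ambient space that
contains [A]; it clusters at a point of [A], and a neighbourhood in the subspace
is the trace of an ambient one. *)
Lemma compact_set_type (X : topologicalType) (A : set X) :
  compact A -> compact [set: set_type A].
Proof.
move=> cA F PF _.
have [|x [Ax clx]] := cA (set_val @ F) (fmap_proper_filter _ _).
  rewrite /fmap/=; apply: (@filterS _ F _ setT); last exact: filterT.
  move=> -[y Ay] _.
  by rewrite set_valE /=; exact: set_mem.
exists (exist _ x (mem_set Ax)); split=> // B V FB.
rewrite nbhsE => -[V' [[W oW <-] /= Wx] sV'V].
have [||y [[b Bb <-] Wb]] := clx (set_val @` B) W.
- by rewrite /fmap/=; apply: filterS FB => b Bb; exists b.
- by apply: open_nbhs_nbhs; split=> //; move: Wx; rewrite set_valE.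
- by exists b; split=> //; exact: sV'V.
Qed.

Lemma discrete_clopen (T : discreteTopologicalType) (A : set T) : clopen A.
Proof. by split; [exact: discrete_open|exact: discrete_closed]. Qed.

(** * Inverse limits of finite groups *)

Section InverseLimit.
Variables (G : nat -> finGroupType) (pr : forall k, G k.+1 -> G k).
Arguments pr k _ : clear implicits.
Hypothesis prM : forall k, {morph pr k : x y / (x * y)%g}.

Local Notation L := (invlim prM).

Lemma invlim_zero_dimensional : zero_dimensional L.
Proof.
move=> g h gh.
have [k ghk] : exists k, coord g k <> coord h k.
  apply/existsNP => gh_eq; move/eqP: gh; apply; exact: coord_inj.
exists ((fun x : L => coord x k : discrete_topology (G k)) @^-1` [set coord g k]).
split=> //=; last exact/nesym.
apply: preimage_clopen; last exact: coord_continuous.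
exact: (@discrete_clopen (discrete_topology (G k))).
Qed.

(** The equation at level [k] involves only the coordinates [k] and [k.+1], and
these are locally constant, so its failure at a point persists nearby. *)
Lemma coherent_compact : compact (coherent pr).
Proof.
have cT : compact [set: prod_topology (fun k => discrete_topology (G k))].
  have := @tychonoff nat (fun k => discrete_topology (G k)) (fun=> setT)
    (fun k => @finite_compact (discrete_topology (G k)) _
      (@finite_finset (G k) setT)).
  by congr (compact _); rewrite eqEsubset.
apply: (subclosed_compact _ cT) => //.
have -> : coherent pr = \bigcap_k [set g | pr k (g k.+1) = g k].
  by rewrite eqEsubset; split => [g Hg k _|g Hg k]; [exact: Hg|exact: Hg k I].
apply: closed_bigI => k _.
rewrite -openC openE => g /= prg; rewrite /interior.
have nbhs_coord j : \forall h \near g, h j = g j.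
  apply: (@proj_continuous _ (fun k => discrete_topology (G k)) j g [set g j]).
  by rewrite nbhs_principalE; exact/principal_filterP.
by apply: filterS2 (nbhs_coord k) (nbhs_coord k.+1) => h /= hk hSk; rewrite hk hSk.
Qed.

Lemma invlim_compact : compact [set: L].
Proof. exact: compact_set_type coherent_compact. Qed.

(** Convergence in the product is coordinatewise, and in a discrete factor it
means being eventually constant. *)
Lemma invlim_cvg (h : nat -> L) (g : L) :
  (forall k n, (k <= n)%N -> coord (h n) k = coord g k) -> h @ \oo --> g.
Proof.
move=> hg U; rewrite nbhsE => -[V' [[W oW <-] /= Wg] sV'U].
have : (\val \o h) @ \oo -->
    (\val g : prod_topology (fun k => discrete_topology (G k))).
  apply/cvg_sup => k V [_ [[B oB <-] Bg] sBV].
  apply: (filterS sBV); exists k => // n /= kn.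
  by move: Bg; rewrite /= -/(coord g k) -(hg k n kn).
move=> /(_ W); rewrite nbhsE => /(_ _)[|N _ HN]; first by exists W => //; split.
exists N => // n Nn; exact/sV'U/HN.
Qed.

(** Fibres with at least two elements allow a section [s] of the projections whose
values at level [k.+1] always differ from the coordinate of [g] there. The point
[h n] follows [g] up to level [n] and the section afterwards, so it differs from
[g] at level [n.+1], while [h n] tends to [g]. *)
Lemma invlim_perfect :
  (forall k (x : G k) (y : G k.+1), exists2 z, pr k z = x & z <> y) ->
  perfect_set [set: L].
Proof.
move=> fib; apply/perfectTP => g og.
pose s k (x : G k) := sval (cid2 (fib k x (coord g k.+1))).
have sP k x : pr k (s k x) = x by rewrite /s; case: cid2.
have s_neq k x : s k x <> coord g k.+1 by rewrite /s; case: cid2.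
pose h n := fix h j : G j :=
  if j is i.+1 then if (i < n)%N then coord g i.+1 else s i (h i) else coord g 0.
have hg n j : (j <= n)%N -> h n j = coord g j by case: j => //= j ->.
have hP n k : pr k (h n k.+1) = h n k.
  by rewrite /=; case: ltnP => kn; [rewrite coordP hg// ltnW|exact: sP].
have : (fun n => of_coords prM (hP n)) @ \oo --> g.
  by apply: invlim_cvg => k n kn; exact: hg.
move=> /(_ [set g]) []; first by apply: open_nbhs_nbhs.
move=> N _ /(_ N (leqnn N)) /= /(congr1 (fun x => coord x N.+1)).
by rewrite /coord /= ltnn; exact: s_neq.
Qed.

Lemma invlim_homeomorphic_cantor (R : realType) :
  (forall k (x : G k) (y : G k.+1), exists2 z, pr k z = x & z <> y) ->
  homeomorphic cantor_space L.
Proof.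
move=> fib.
have clL : cantor_like L.
  split.
  - exact: invlim_perfect.
  - exact: invlim_compact.
  - exact: zero_dimensional_hausdorff invlim_zero_dimensional.
  - exact: invlim_zero_dimensional.
(* The countable product carries a pseudometric, inherited by the subspace; its
   topology is the one of the inverse limit by conversion. *)
pose X : pseudoMetricType R := prod_topology (fun k => discrete_topology (G k)).
pose T : pseudoMetricType R := set_type (coherent pr : set X).
have TL : (T : topologicalType) = (L : topologicalType) by reflexivity.
rewrite -TL in clL *.
apply: cantor_like_homeomorphic clL.
exact: inhabits (1%g : L).
Qed.

End InverseLimit.

(** * Fibres of the projections of wreath products *)

Lemma iter_wreath_set_inhabited (n : nat -> nat) (k : nat) :
  (forall i, 0 < n i)%N -> inhabited (ag_set (iter_wreath n k)).
Proof.
move=> n_gt0; elim: k => [|k [x]] /=; first exact: inhabits (Ordinal (n_gt0 0)).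
exact: inhabits (x, Ordinal (n_gt0 k.+1)).
Qed.

(** The elements [u c] form the diagonal copy of [B] in the base group, translated
to lie over [a]; the values of [u] at [1] and at [b <> 1] cannot both be [y].
The point [x] makes sure that the base group has at least one factor. *)
Lemma wreath_proj_fiber (A B : actingGroup) (x : ag_set A) (b : ag_group B)
    (a : ag_group A) (y : ag_group (wreath A B)) :
  b <> 1%g -> exists2 z : ag_group (wreath A B), wreath_proj z = a & z <> y.
Proof.
move=> b1.
pose u (c : ag_group B) : ag_group (wreath A B) :=
  @SdPair _ _ _ _ (base_groupAction A B) (a, [ffun=> c])
    (introT setXP (conj (finset.in_setT _) (finset.in_setT _))).
have u_inj c d : u c = u d -> c = d.
  by move=> /(congr1 (fun v : wreath_group A B =>
    ((pair_of_sd v).2 : {dffun forall _ : ag_set A, ag_group B}) x));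
    rewrite /= !ffunE.
have [uy|uy] := pselect (u 1%g = y); last by exists (u 1%g).
by exists (u b) => //; rewrite -uy => /u_inj.
Qed.

Lemma iter_wreath_proj_fiber (n : nat -> nat) (k : nat)
    (a : ag_group (iter_wreath n k)) (y : ag_group (iter_wreath n k.+1)) :
  (forall i, (2 <= n i)%N) ->
  exists2 z, iter_wreath_proj z = a & z <> y.
Proof.
move=> n_ge2.
have [x] : inhabited (ag_set (iter_wreath n k)).
  by apply: iter_wreath_set_inhabited => i; exact: leq_trans (n_ge2 i).
pose i0 := Ordinal (leq_trans (isT : 0 < 2)%N (n_ge2 k.+1)).
pose i1 := Ordinal (n_ge2 k.+1).
apply: (@wreath_proj_fiber _ (sym_acting (n k.+1)) x (tperm i0 i1)).
by move=> /permP /(_ i0); rewrite tpermL perm1 => /(congr1 val).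
Qed.

(** * The middle-thirds set *)

Section CantorSet.
Variable R : realType.
Local Open Scope ring_scope.
Implicit Types (A : set R) (x y c : R).

Local Notation C_ k := (iter k (@cantor_step R) `[0, 1]%classic).

Lemma cantor_stepE A x :
  cantor_step A x <-> A (3 * x) \/ A (3 * x - 2).
Proof.
split=> [[[y Ay <-]|[y Ay <-]]|[Ax|Ax]].
- by left; rewrite (_ : 3 * (y / 3) = y)//; lra.
- by right; rewrite (_ : 3 * (2 / 3 + y / 3) - 2 = y)//; lra.
- by left; exists (3 * x) => //; lra.
- by right; exists (3 * x - 2) => //; lra.
Qed.

Lemma cantor_iter_itv k x : C_ k x -> 0 <= x <= 1.
Proof.
elim: k x => [|k IHk] x; first by rewrite /= in_itv.
by move=> /= /cantor_stepE[] /IHk; lra.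
Qed.

(** At every stage all points lie in the unit interval, so the side of 1/2 on which
[x] lies decides, for all stages at once, which of the two copies contains it. *)
Lemma cantor_set_self_similar x :
  cantor_set R x <-> cantor_set R (3 * x) \/ cantor_set R (3 * x - 2).
Proof.
split=> [Cx|Cx]; last first.
  case=> [|k] _.
    by case: Cx => /(_ 0%N I); rewrite /= !in_itv /=; lra.
  by apply/cantor_stepE; case: Cx => /(_ k I); [left|right].
have [xle|xgt] := lerP x (2^-1).
  left=> k _; have := Cx k.+1 I => /cantor_stepE[//|/cantor_iter_itv]; lra.
right=> k _; have := Cx k.+1 I => /cantor_stepE[/cantor_iter_itv|//]; lra.
Qed.

Lemma cantor_set0 : cantor_set R 0.
Proof.
move=> k _; elim: k => [|k IHk]; first by rewrite /= in_itv/= lexx ler01.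
by apply/cantor_stepE; left; rewrite mulr0.
Qed.

Lemma cantor_set1 : cantor_set R 1.
Proof.
move=> k _; elim: k => [|k IHk]; first by rewrite /= in_itv/= lexx ler01.
by apply/cantor_stepE; right; rewrite (_ : 3 * 1 - 2 = 1)//; lra.
Qed.

Lemma cantor_set_compact : compact (cantor_set R).
Proof.
have C0 : cantor_set R `<=` `[0, 1]%classic by move=> x /(_ 0%N I).
apply: (subclosed_compact _ (@segment_compact R 0 1) C0).
apply: closed_bigI => k _; elim: k => [|k IHk] /=; first exact: itv_closed.
have -> : cantor_step (C_ k) =
    (fun x => 3 * x) @^-1` C_ k `|` (fun x => 3 * x - 2) @^-1` C_ k.
  by apply/seteqP; split=> x /cantor_stepE.
have c3 : continuous (fun x : R => 3 * x) by exact: mulrl_continuous.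
apply: closedU; apply: (continuous_closedP _).1 IHk => // x.
by apply: cvgB; [exact: c3|exact: cvg_cst].
Qed.

(** If both points lie in the same third, rescaling that third triples their
distance and reduces to the previous stage; otherwise the midpoint 1/2 of the
first removed interval separates them. At stage 0
no two points are far enough apart. *)
Lemma cantor_iter_gap k x y :
  C_ k x -> C_ k y -> 3^-1 ^+ k < y - x -> exists2 c, x < c < y & ~ C_ k c.
Proof.
elim: k x y => [|k IHk] x y.
  by rewrite expr0 /= !in_itv /=; lra.
move=> /cantor_stepE Cx /cantor_stepE Cy; rewrite exprS => xy.
have pow_ge0 : 0 <= 3^-1 ^+ k :> R by rewrite exprn_ge0// invr_ge0.
case: Cx Cy => Cx [] Cy.
- have [|c xcy nCc] := IHk _ _ Cx Cy; first lra.
  exists (c / 3); first lra.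
  have := cantor_iter_itv Cx; have := cantor_iter_itv Cy => ? ?.
  move=> /cantor_stepE[|/cantor_iter_itv]; last lra.
  by rewrite (_ : 3 * (c / 3) = c)//; lra.
- have := cantor_iter_itv Cx; have := cantor_iter_itv Cy => ? ?.
  exists 2^-1; first lra.
  by move=> /cantor_stepE[] /cantor_iter_itv; lra.
- by have := cantor_iter_itv Cx; have := cantor_iter_itv Cy; lra.
- have [|c xcy nCc] := IHk _ _ Cx Cy; first lra.
  exists (2 / 3 + c / 3); first lra.
  have := cantor_iter_itv Cx; have := cantor_iter_itv Cy => ? ?.
  move=> /cantor_stepE[/cantor_iter_itv|]; first lra.
  by rewrite (_ : 3 * (2 / 3 + c / 3) - 2 = c)//; lra.
Qed.

Lemma expr_inv3_lt (e : R) : 0 < e -> exists k, 3^-1 ^+ k < e.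
Proof.
move=> e0.
have : (fun k => 3^-1 ^+ k : R) @ \oo --> (0 : R).
  by apply: cvg_expr; rewrite ger0_norm; lra.
move=> /cvgrPdist_lt /(_ e e0) [k _ /(_ k (leqnn k))] /=.
rewrite sub0r normrN ger0_norm ?exprn_ge0 ?invr_ge0// => ke.
by exists k.
Qed.

(** A point [c] outside the set splits it into the clopen parts [z < c] and
[z > c], and [cantor_iter_gap] provides such a [c] between any two points. *)
Lemma cantor_set_zero_dimensional : zero_dimensional (set_type (cantor_set R)).
Proof.
have cval : continuous (set_val : set_type (cantor_set R) -> R).
  exact: initial_continuous.
pose cut c : set (set_type (cantor_set R)) := [set z | set_val z < c].
have cut_clopen c : ~ cantor_set R c -> clopen (cut c).
  move=> nCc; split.
    by apply: (@open_comp _ _ set_val [set z : R | z < c]) => [z _|];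
      [exact: cval|exact: open_lt].
  (* On the set, [z < c] and [z <= c] agree because [c] is not in it. *)
  have -> : cut c = set_val @^-1` [set z : R | z <= c].
    apply/seteqP; split=> -[z Cz] /=; rewrite /cut /= set_valE /=.
      exact: ltW.
    rewrite le_eqVlt => /predU1P[zc|//].
    by case: nCc; rewrite -zc; exact: set_mem.
  by apply: (continuous_closedP _).1; [exact: cval|exact: closed_le].
have sep (x y : set_type (cantor_set R)) : set_val x < set_val y ->
    exists2 c, set_val x < c < set_val y & ~ cantor_set R c.
  rewrite -subr_gt0 => /expr_inv3_lt[k kxy].
  have [||c xcy nCc] := @cantor_iter_gap k (set_val x) (set_val y) _ _ kxy.
  - by case: x {kxy} => x Cx; rewrite set_valE /=; exact: (set_mem Cx k I).
  - by case: y {kxy} => y Cy; rewrite set_valE /=; exact: (set_mem Cy k I).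
  - by exists c => // /(_ k I).
move=> x y xy.
have [/sep[c lt_xcy /cut_clopen cc]|/sep[c lt_ycx /cut_clopen cc]|/val_inj exy] :=
  ltgtP (set_val x) (set_val y).
- case/andP: lt_xcy => lt_xc lt_cy; exists (cut c); split=> // lt_yc.
  by have := lt_trans lt_cy lt_yc; rewrite ltxx.
- case/andP: lt_ycx => lt_yc lt_cx; exists (~` cut c).
  split; [exact: (@clopenC _ _ setT cc)|move=> lt_xc|by apply].
  by have := lt_trans lt_cx lt_xc; rewrite ltxx.
- by rewrite exy eqxx in xy.
Qed.

(** The endpoints 0 and 1 give the case [k = 0], and the scaling maps by 1/3 carry
a neighbour of the rescaled point to a neighbour three times closer. *)
Lemma cantor_set_near k x : cantor_set R x ->
  exists2 y, cantor_set R y /\ y != x & `|x - y| <= 3^-1 ^+ k.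
Proof.
elim: k x => [|k IHk] x Cx.
  have := Cx 0%N I; rewrite expr0 /= in_itv /= => x01.
  have [x_eq0|x_neq0] := eqVneq x 0.
    exists 1; first by split; [exact: cantor_set1|rewrite x_eq0 oner_eq0].
    by rewrite ler_norml; lra.
  exists 0; first by split; [exact: cantor_set0|rewrite eq_sym].
  by rewrite ler_norml; lra.
have [/IHk|/IHk] := (cantor_set_self_similar x).1 Cx => -[y [Cy yx]];
  rewrite exprS !ler_norml => xy.
- exists (y / 3); last by rewrite ler_norml; lra.
  split; last by apply: contra_neq yx => <-; lra.
  by apply/cantor_set_self_similar; left; rewrite (_ : 3 * (y / 3) = y)//; lra.
- exists (2 / 3 + y / 3); last by rewrite ler_norml; lra.
  split; last by apply: contra_neq yx => <-; lra.
  apply/cantor_set_self_similar; right.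
  by rewrite (_ : 3 * (2 / 3 + y / 3) - 2 = y)//; lra.
Qed.

Lemma cantor_set_perfect : perfect_set [set: set_type (cantor_set R)].
Proof.
apply/perfectTP => -[x Cx] [W oW Wx].
have Wx' : W x.
  by have : (set_val @^-1` W) (exist _ x Cx); [rewrite Wx|rewrite /= set_valE].
have : nbhs x W by exact: open_nbhs_nbhs.
move=> /nbhs_ballP[e /= e0 xeW].
have [k ke] := expr_inv3_lt e0.
have [y [Cy yx] xy] := cantor_set_near k (set_mem Cx).
have : (set_val @^-1` W) (exist _ y (mem_set Cy)).
  by rewrite /= set_valE; apply: xeW; exact: le_lt_trans ke.
by rewrite Wx => /(congr1 val) /= /eqP; exact/negP.
Qed.

Lemma cantor_set_homeomorphic_cantor :
  homeomorphic cantor_space (set_type (cantor_set R)).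
Proof.
apply: cantor_like_homeomorphic.
  exact: inhabits (exist _ 0 (mem_set cantor_set0)).
split.
- exact: cantor_set_perfect.
- exact: compact_set_type cantor_set_compact.
- exact: zero_dimensional_hausdorff cantor_set_zero_dimensional.
- exact: cantor_set_zero_dimensional.
Qed.

End CantorSet.

(** * The homeomorphism *)

Theorem mainTheorem8 (R : realType) (n : nat -> nat)
    (hn : forall i : nat, (3 <= n i)%N) :
  homeomorphic (inf_wreath n) (set_type (cantor_set R)).
Proof.
apply: homeomorphic_trans (cantor_set_homeomorphic_cantor R).
apply: homeomorphic_sym; apply: (invlim_homeomorphic_cantor _ R) => k a y.
by apply: iter_wreath_proj_fiber => i; exact: ltnW.
Qed.
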